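(* Let $A, B\in \mathbb{C}^{m\times n}$ be such that $A^*B=0$ (that is, $A$ is left $*$-orthogonal to $B$). Then $A$ is parallel summable to $B$ if and only if $\mathcal{R}(\overline{P}_ABA^* )\subseteq \mathcal{R}(\overline{P}_AB\overline{Q}_A)$. In this case, $A:B=0$.
   Context: $M^*$ is the conjugate transpose, $\mathcal{R}(M)$ the column space, and $M^\dagger$ the Moore-Penrose inverse of $M$. Put $\overline{P}_A=I_m-AA^\dagger$ and $\overline{Q}_A=I_n-A^\dagger A$. A $g$-inverse (inner inverse) of $M\in\mathbb{C}^{m\times n}$ is any matrix $M^-\in\mathbb{C}^{n\times m}$ with $MM^-M=M$. Matrices $A,B\in \mathbb{C}^{m\times n}$, at least one of which is nonzero, are called parallel summable if $A(A+B)^{-}B$ is invariant under the choice of the $g$-inverse $(A+B)^{-}$ of $A+B$; in that case the common value is called the parallel sum of $A$ and $B$ and is denoted $A:B$ (so $A:B=A(A+B)^\dagger B$). ''$A$ is parallel summable to $B$'' means that $A$ and $B$ are parallel summable. *)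

(* Defs.v *)
From HB Require Import structures.
From mathcomp Require Import all_boot all_order all_algebra.
From mathcomp Require Import spectral sesquilinear.
From mathcomp Require Import boolp classical_sets reals.
From mathcomp Require Import complex.

Set Implicit Arguments.
Unset Strict Implicit.
Unset Printing Implicit Defensive.

Import Order.TTheory GRing.Theory Num.Theory.
Local Open Scope ring_scope.
Local Open Scope sesquilinear_scope.

Section Definitions.
Variable C : numClosedFieldType.
Implicit Types m n : nat.

(* The column space, as a set of column vectors; MathComp's [<=%MS] compares
   row spaces instead. *)
Definition colspace m n (M : 'M[C]_(m, n)) : set 'cV[C]_m :=
  [set M *m u | u in [set: 'cV[C]_n]]%classic.

Definition ginverse m n (M : 'M[C]_(m, n)) (X : 'M[C]_(n, m)) : Prop :=
  M *m X *m M = M.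

Definition penrose m n (M : 'M[C]_(m, n)) (X : 'M[C]_(n, m)) : Prop :=
  [/\ M *m X *m M = M, X *m M *m X = X,
      (M *m X)^t* = M *m X & (X *m M)^t* = X *m M].

(* The default value 0 is never used: see [mpinvP] and [mpinv_unique]. *)
Definition mpinv m n (M : 'M[C]_(m, n)) : 'M[C]_(n, m) :=
  xget 0 [set X | penrose M X]%classic.

Definition Pbar m n (A : 'M[C]_(m, n)) : 'M[C]_m := 1%:M - A *m mpinv A.

Definition Qbar m n (A : 'M[C]_(m, n)) : 'M[C]_n := 1%:M - mpinv A *m A.

(* The notion is usually reserved for pairs (A, B) with A or B nonzero; the
   degenerate pair (0, 0) satisfies the invariance condition trivially and is
   not excluded here. *)
Definition parallel_summable m n (A B : 'M[C]_(m, n)) : Prop :=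
  forall X Y : 'M[C]_(n, m), ginverse (A + B) X -> ginverse (A + B) Y ->
    A *m X *m B = A *m Y *m B.

(* The common value of A (A + B)^- B over all g-inverses; it is meaningful
   only for parallel summable A and B, see [parallel_sumE]. *)
Definition parallel_sum m n (A B : 'M[C]_(m, n)) : 'M[C]_(m, n) :=
  xget 0 [set S | forall X, ginverse (A + B) X -> S = A *m X *m B]%classic.

Lemma conjTM m n p (A : 'M[C]_(m, n)) (B : 'M[C]_(n, p)) :
  (A *m B)^t* = B^t* *m A^t*.
Proof. by rewrite trmx_mul map_mxM. Qed.

Lemma row_free_gram m n (A : 'M[C]_(m, n)) :
  row_free A -> A *m A^t* \in unitmx.
Proof.
move=> fA; rewrite -row_free_unit; apply/inj_row_free => v vAA0.
have vA0 : dotmx (v *m A) (v *m A) = 0.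
  by rewrite dotmxE conjTM mulmxA -(mulmxA v) vAA0 mul0mx mxE.
apply/eqP; rewrite -(mulmx_free_eq0 v fA).
by rewrite -(dnorm_eq0 (@dotmx C n)); apply/eqP.
Qed.

Lemma conjT_inv n (A : 'M[C]_n) : A^t* = A -> (invmx A)^t* = invmx A.
Proof. by move=> hA; rewrite trmx_inv map_invmx hA. Qed.

Lemma mpinv_exists m n (M : 'M[C]_(m, n)) : exists X, penrose M X.
Proof.
have := mulmx_base M; have := col_base_full M; have := row_base_free M.
move: (\rank M) (col_base M) (row_base M) => r F G fG fF FG.
have uG : G *m G^t* \in unitmx by exact: row_free_gram.
have uF : F^t* *m F \in unitmx.
  rewrite -{2}(trmxCK F); apply: row_free_gram.
  by rewrite /row_free mxrank_map mxrank_tr.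
have hG : (G *m G^t*)^t* = G *m G^t* by rewrite conjTM trmxCK.
have hF : (F^t* *m F)^t* = F^t* *m F by rewrite conjTM trmxCK.
pose Fi := invmx (F^t* *m F) *m F^t*; pose Gi := G^t* *m invmx (G *m G^t*).
have FiF : Fi *m F = 1%:M by rewrite /Fi -mulmxA mulVmx.
have GGi : G *m Gi = 1%:M by rewrite /Gi mulmxA mulmxV.
have MX : M *m (Gi *m Fi) = F *m Fi.
  by rewrite -FG mulmxA -(mulmxA F) GGi mulmx1.
have XM : Gi *m Fi *m M = Gi *m G.
  by rewrite -FG mulmxA -(mulmxA Gi) FiF mulmx1.
exists (Gi *m Fi); split.
- by rewrite MX -FG mulmxA -(mulmxA F) FiF mulmx1.
- by rewrite XM mulmxA -(mulmxA Gi) GGi mulmx1.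
- by rewrite MX /Fi !conjTM trmxCK conjT_inv // mulmxA.
- by rewrite XM /Gi !conjTM trmxCK conjT_inv // mulmxA.
Qed.

Lemma mpinvP m n (M : 'M[C]_(m, n)) : penrose M (mpinv M).
Proof. exact: (xgetPex 0 (mpinv_exists M)). Qed.

Lemma mpinv_unique m n (M : 'M[C]_(m, n)) X : penrose M X -> mpinv M = X.
Proof.
case: (mpinvP M); set Y := mpinv M => Y1 Y2 Y3 Y4 [X1 X2 X3 X4].
have MXY : M *m Y = M *m X.
  by rewrite -{1}X1 -(mulmxA _ M Y) -X3 -Y3 -conjTM mulmxA Y1 X3.
have XYM : Y *m M = X *m M.
  by rewrite -{1}X1 -(mulmxA M X M) mulmxA -X4 -Y4 -conjTM -(mulmxA X M) (mulmxA M) Y1 X4.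
by rewrite -Y2 XYM -mulmxA MXY mulmxA X2.
Qed.

Lemma mpinv_ginverse m n (M : 'M[C]_(m, n)) : ginverse M (mpinv M).
Proof. by case: (mpinvP M). Qed.

Lemma parallel_sumE m n (A B : 'M[C]_(m, n)) X :
  parallel_summable A B -> ginverse (A + B) X ->
  parallel_sum A B = A *m X *m B.
Proof.
move=> sAB gX; apply: xget_unique => [Y gY|S]; first exact: sAB.
exact.
Qed.

Lemma parallel_sum_mpinv m n (A B : 'M[C]_(m, n)) :
  parallel_summable A B -> parallel_sum A B = A *m mpinv (A + B) *m B.
Proof. by move=> sAB; apply/parallel_sumE/mpinv_ginverse. Qed.

End Definitions.

(* Main.v *)
(** Put M = A + B.  Since A^* B = 0, also A^+ B = 0, so Pbar_A B = B and
    A = A A^+ M.  Hence A X B depends on the choice of the g-inverse X of M only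
    through the column condition R(B) <= R(M) (when A <> 0).  Projecting
    B = M W along R(A) gives A W = 0 and B = B Qbar_A W, so that condition means
    R(B) <= R(B Qbar_A), which is equivalent to R(B A^* ) <= R(B Qbar_A) because
    B = B Qbar_A + B A^* (A^+)^*.  Under it A X B = A A^+ M X M W = A A^+ B = 0. *)
Require Import Defs.
From mathcomp Require Import all_boot all_order all_algebra.
From mathcomp Require Import spectral sesquilinear.
From mathcomp Require Import boolp classical_sets reals.
From mathcomp Require Import complex.
Import GRing.Theory Num.Theory.
Local Open Scope ring_scope.
Local Open Scope sesquilinear_scope.
Local Open Scope classical_set_scope.

Set Implicit Arguments.

(** Taking for [U] the matrix unit at [(j, k)], the [(i, l)] entry of [A U D] is [A i j * D k l], so
    one nonzero entry of [A] kills every entry of [D]. *)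
Lemma mulmx_prime (F : fieldType) (m n p q : nat)
    (A : 'M[F]_(m, n)) (D : 'M[F]_(p, q)) :
  (forall U, A *m U *m D = 0) -> A = 0 \/ D = 0.
Proof.
move=> AUD; have [->|/matrix0Pn[i [j Aij]]] := eqVneq A 0; [by left | right].
apply/matrixP => k l; have /matrixP/(_ i l)/eqP := AUD (delta_mx j k).
rewrite -(mul_delta_mx (0 : 'I_1)) mulmxA -colE -mulmxA -rowE.
by rewrite mxE big_ord1 !mxE mulf_eq0 (negPf Aij) => /eqP.
Qed.

Section ColumnSpace.
Variable C : numClosedFieldType.

Lemma colspace_mulmx (m n p : nat) (K : 'M[C]_(m, n)) (Z : 'M[C]_(n, p)) :
  colspace (K *m Z) `<=` colspace K.
Proof. by move=> _ [u _ <-]; exists (Z *m u) => //; rewrite mulmxA. Qed.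

Lemma colspace_subP (m n p : nat) (N : 'M[C]_(m, p)) (K : 'M[C]_(m, n)) :
  colspace N `<=` colspace K <-> exists Z, N = K *m Z.
Proof.
split=> [sNK | [Z ->]]; last exact: colspace_mulmx.
(* Transposing reduces the claim to row spaces, where it is tested on one column of [N] at a
   time. *)
have /submxP[Z NZ] : (N^T <= K^T)%MS.
  apply/row_subP => i; rewrite -tr_col.
  have [|u _ Ku] := sNK (col i N).
    by exists (delta_mx i 0) => //; rewrite -colE.
  by rewrite -Ku trmx_mul submxMl.
by exists Z^T; rewrite -[N]trmxK NZ trmx_mul trmxK.
Qed.

End ColumnSpace.

(** The added term vanishes because [(1 - M X) M = 0]. The freedom in [U] is what makes invariance a
    strong condition. *)
Lemma ginverse_perturb (C : numClosedFieldType) (m n : nat)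
    (M : 'M[C]_(m, n)) (X : 'M[C]_(n, m)) (U : 'M[C]_(n, m)) :
  ginverse M X -> ginverse M (X + U *m (1%:M - M *m X)).
Proof.
rewrite /ginverse => gX.
rewrite mulmxDr mulmxDl gX -(mulmxA M (U *m _)) -(mulmxA U) mulmxBl mul1mx gX.
by rewrite subrr !mulmx0 addr0.
Qed.

Section StarOrthogonal.
Variables (C : numClosedFieldType) (m n : nat) (A B : 'M[C]_(m, n)).
Hypothesis AB0 : A^t* *m B = 0.
Let M := A + B.

Lemma mpinv_star_orthogonal : mpinv A *m B = 0.
Proof.
have [_ AAA AAh _] := mpinvP A.
(* As [A A^+] is Hermitian, [A^+ = A^+ (A A^+)^* = A^+ (A^+)^* A^*], which ends in [A^*]. *)
by rewrite -AAA -(mulmxA _ A) -AAh conjTM -!mulmxA AB0 !mulmx0.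
Qed.

Lemma Pbar_star_orthogonal : Pbar A *m B = B.
Proof.
by rewrite /Pbar mulmxBl mul1mx -mulmxA mpinv_star_orthogonal mulmx0 subr0.
Qed.

Lemma mpinv_mul_sum : A *m mpinv A *m M = A.
Proof.
rewrite mulmxDr (mpinv_ginverse A) -mulmxA mpinv_star_orthogonal.
by rewrite mulmx0 addr0.
Qed.

Lemma mul_Qbar : A *m Qbar A = 0.
Proof. by rewrite /Qbar mulmxBr mulmx1 mulmxA (mpinv_ginverse A) subrr. Qed.

Lemma colspace_sum_Qbar :
  colspace B `<=` colspace M <-> colspace B `<=` colspace (B *m Qbar A).
Proof.
rewrite !colspace_subP; split=> -[W BW].
  have AW : A *m W = 0.
    by rewrite -mpinv_mul_sum -mulmxA -BW -mulmxA mpinv_star_orthogonal mulmx0.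
  (* From [A W = 0], [Qbar A] fixes [W] and [B = M W] becomes [B = B W]. *)
  exists W; rewrite -mulmxA /Qbar mulmxBl mul1mx -(mulmxA _ A) AW mulmx0 subr0.
  by rewrite {1}BW mulmxDl AW add0r.
(* Conversely [M Qbar = B Qbar], since [A Qbar = 0]. *)
by exists (Qbar A *m W); rewrite mulmxA mulmxDl mul_Qbar add0r.
Qed.

Lemma colspace_conj_Qbar :
  colspace (B *m A^t*) `<=` colspace (B *m Qbar A) <->
  colspace B `<=` colspace (B *m Qbar A).
Proof.
split=> [/colspace_subP[Z BZ] | sB]; last first.
  by apply: subset_trans sB; exact: colspace_mulmx.
have [_ _ _ QAh] := mpinvP A.
(* The second summand accounts for [B A^+ A = B A^* (A^+)^*], by hermitian symmetry of [A^+ A]. *)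
apply/colspace_subP; exists (1%:M + Z *m (mpinv A)^t*).
rewrite mulmxDr mulmx1 mulmxA -BZ -mulmxA -conjTM QAh.
by rewrite -mulmxDr /Qbar subrK mulmx1.
Qed.

Lemma mul_ginverse_eq0 X :
  colspace B `<=` colspace M -> ginverse M X -> A *m X *m B = 0.
Proof.
move=> /colspace_subP[W BW] MXM.
rewrite -mpinv_mul_sum [in LHS]BW mulmxA -2!(mulmxA (A *m mpinv A)) MXM.
by rewrite -mulmxA -BW -mulmxA mpinv_star_orthogonal mulmx0.
Qed.

Lemma parallel_summable_colspace :
  parallel_summable A B -> A = 0 \/ colspace B `<=` colspace M.
Proof.
move=> sAB; have gM := mpinv_ginverse M.
suff [->|D0] : A = 0 \/ (1%:M - M *m mpinv M) *m B = 0; first by left.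
  right; apply/colspace_subP; exists (mpinv M *m B); apply/eqP.
  by rewrite -subr_eq0 mulmxA -[X in X - _]mul1mx -mulmxBl D0.
(* Comparing [M^+] with its perturbation by [U] leaves [A U (1 - M M^+) B = 0]. *)
apply: mulmx_prime => U.
have gU := ginverse_perturb U gM.
have /eqP := sAB _ _ gU gM.
by rewrite mulmxDr mulmxDl -subr_eq0 addrAC subrr add0r !mulmxA => /eqP.
Qed.

End StarOrthogonal.

Unset Implicit Arguments.

Theorem theorem2p14 (R : realType) (m n : nat) (A B : 'M[R[i]]_(m, n)) :
  A^t* *m B = 0 ->
  (parallel_summable A B <->
     colspace (Pbar A *m B *m A^t*) `<=` colspace (Pbar A *m B *m Qbar A)) /\
  (parallel_summable A B -> parallel_sum A B = 0).
Proof.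
move=> AB0; rewrite (Pbar_star_orthogonal AB0).
split; [split|] => [sAB|sBA|sAB].
- have [A0|sBM] := parallel_summable_colspace sAB.
    by apply/colspace_subP; exists 0; rewrite A0 trmx0 map_mx0 !mulmx0.
  by apply/colspace_conj_Qbar/colspace_sum_Qbar.
- move: sBA => /colspace_conj_Qbar/(colspace_sum_Qbar AB0) sBM X Y gX gY.
  (* Invariance holds because both values are 0. *)
  by rewrite !mul_ginverse_eq0.
- rewrite parallel_sum_mpinv //.
  have [->|sBM] := parallel_summable_colspace sAB.
    by rewrite !mul0mx.
  by rewrite mul_ginverse_eq0 //; exact: mpinv_ginverse.
Qed.
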